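(* Let $\mathcal{A}$ be an algebra, let $f, g_1, g_2, h_1, h_2 : \mathcal{A} \to \mathcal{A}$ be mappings with $f$ additive, and suppose that $$f(ab) = g_1(a) h_1(b) + g_2(a) h_2(b)\qquad\text{for all } a, b \in \mathcal{A}.$$ Suppose that $[g_1, g_2] = [h_1, h_2] = 0$. Then, for each $n \in \mathbb{N}$ and all $a, b \in \mathcal{A}$, $$f^{n}(ab) = \sum_{k = 0}^{n}\binom{n}{k}\, g_1^{n - k}\big(g_2^{k}(a)\big)\, h_1^{n -k}\big(h_2^{k}(b)\big),$$ where $g_1^{0} = g_2^0 = h_1^0 = h_2^{0} = I$.
   Context: $\mathcal{A}$ is an (associative, not necessarily unital or commutative) algebra. Mappings $\mathcal{A}\to\mathcal{A}$ are not assumed additive or linear unless stated. $I$ is the identity mapping of $\mathcal{A}$; $TS$ denotes the composition $T\circ S$, $T^n$ is the $n$-fold composition of $T$ with itself, and $[T,S] = TS - ST$ for mappings $T,S:\mathcal{A}\to\mathcal{A}$, so $[T,S]=0$ means $T(S(a)) = S(T(a))$ for all $a \in \mathcal{A}$. $\mathbb{N}$ is the set of positive integers. An additive mapping $f$ satisfying the displayed identity is called a $(g_1,h_1,g_2,h_2)$-derivation. *)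

(* Defs.v *)
From HB Require Import structures.
From mathcomp Require Import all_boot all_order all_algebra.

Set Implicit Arguments.
Unset Strict Implicit.
Unset Printing Implicit Defensive.

Import GRing.Theory.
Local Open Scope ring_scope.

(* [algType] requires a multiplicative unit; this is the variant without one. *)
HB.mixin Record Lmodule_isAssocAlgebra (K : comPzRingType) (A : Type)
    of GRing.Lmodule K A := {
  amul : A -> A -> A;
  amulA : associative amul;
  amulDl : left_distributive amul +%R;
  amulDr : right_distributive amul +%R;
  ascalerAl : forall (c : K) (a b : A), c *: amul a b = amul (c *: a) b;
  ascalerAr : forall (c : K) (a b : A), c *: amul a b = amul a (c *: b)
}.

#[short(type="assocAlgType")]
HB.structure Definition AssocAlgebra (K : comPzRingType) :=
  { A of GRing.Lmodule K A & Lmodule_isAssocAlgebra K A }.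

Notation "a ** b" := (amul a b) (at level 40, left associativity) : ring_scope.

Definition map_comm (A : zmodType) (T S : A -> A) : A -> A :=
  (T \o S) \- (S \o T).

(* Main.v *)
(* The array [w m k = g1^m (g2^k a) ** h1^m (h2^k b)] satisfies
   [f (w m k) = w m.+1 k + w m k.+1], the commutation hypotheses being needed
   for the second summand; the formula is then Pascal's rule. *)
Require Import Defs.
From HB Require Import structures.
From mathcomp Require Import all_boot all_order all_algebra.

Set Implicit Arguments.
Unset Strict Implicit.
Unset Printing Implicit Defensive.

Import GRing.Theory.
Local Open Scope ring_scope.

Lemma morphD_morph0 (V W : zmodType) (f : V -> W) :
  {morph f : x y / x + y} -> f 0 = 0.
Proof. by move=> fD; apply: (addrI (f 0)); rewrite -fD !addr0. Qed.

Lemma morphD_mulrn (V W : zmodType) (f : V -> W) (n : nat) :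
  {morph f : x y / x + y} -> {morph f : x / x *+ n}.
Proof.
move=> fD x; elim: n => [|n IHn]; first by rewrite !mulr0n morphD_morph0.
by rewrite !mulrS fD IHn.
Qed.

Lemma iter_pascal (V : zmodType) (f : V -> V) (w : nat -> nat -> V) :
    {morph f : x y / x + y} ->
    (forall m k, f (w m k) = w m.+1 k + w m k.+1) ->
  forall n, iter n f (w 0 0) = \sum_(0 <= k < n.+1) w (n - k)%N k *+ 'C(n, k).
Proof.
move=> fD fw; elim=> [|n IHn]; first by rewrite big_nat1 bin0.
rewrite iterS IHn (big_morph f fD (morphD_morph0 fD)).
have -> : \sum_(0 <= k < n.+1) f (w (n - k)%N k *+ 'C(n, k)) =
    \sum_(0 <= k < n.+1) (w (n.+1 - k)%N k *+ 'C(n, k)) +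
    \sum_(0 <= k < n.+1) (w (n - k)%N k.+1 *+ 'C(n, k)).
  (* Subtraction is truncated, so turning [(n - k).+1] into [n.+1 - k] needs the bound [k <= n];
     hence the congruence that keeps the range. *)
  rewrite -big_split; apply: eq_big_nat => k /andP[_ le_kn] /=.
  by rewrite morphD_mulrn // fw mulrnDl subSn.
(* The extra term [k = n.+1] is free because ['C(n, n.+1) = 0]; this sum now has the range of the
   goal. *)
have -> : \sum_(0 <= k < n.+1) (w (n.+1 - k)%N k *+ 'C(n, k)) =
    \sum_(0 <= k < n.+2) (w (n.+1 - k)%N k *+ 'C(n, k)).
  by rewrite [RHS]big_nat_recr //= bin_small // mulr0n addr0.
(* Splitting off [k = 0] on both sides shifts the remaining indices to [k.+1], in line with the
   second sum, so Pascal's rule applies termwise. *)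
rewrite !(big_nat_recl n.+1) //= !bin0 -addrA -big_split; congr (_ + _).
by apply: eq_bigr => k _ /=; rewrite binS mulrnDr subSS.
Qed.

Lemma map_comm_eq0 (A : zmodType) (T S : A -> A) :
  map_comm T S =1 \0 -> forall x, T (S x) = S (T x).
Proof. by move=> TS x; apply/eqP; rewrite -subr_eq0; apply/eqP/TS. Qed.

Lemma iter_comm (T : Type) (f g : T -> T) :
  (forall x, f (g x) = g (f x)) -> forall n x, iter n f (g x) = g (iter n f x).
Proof. by move=> fg; elim=> //= n IHn x; rewrite IHn fg. Qed.

Theorem theorem2p1 (K : comPzRingType) (A : assocAlgType K)
    (f g1 g2 h1 h2 : A -> A)
    (f_additive : {morph f : x y / x + y})
    (f_mul : forall a b : A, f (a ** b) = g1 a ** h1 b + g2 a ** h2 b)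
    (g_comm : map_comm g1 g2 =1 \0)
    (h_comm : map_comm h1 h2 =1 \0)
    (n : nat) (n_gt0 : (0 < n)%N) (a b : A) :
  iter n f (a ** b) =
    \sum_(0 <= k < n.+1)
      (iter (n - k) g1 (iter k g2 a) ** iter (n - k) h1 (iter k h2 b))
        *+ 'C(n, k).
Proof.
have g12 := iter_comm (map_comm_eq0 g_comm).
have h12 := iter_comm (map_comm_eq0 h_comm).
pose w m k := iter m g1 (iter k g2 a) ** iter m h1 (iter k h2 b).
(* [w 0 0] is [a ** b] by computation, so only the recurrence for [w] remains. *)
apply: (iter_pascal (w := w)) => // m k.
(* In [w m k.+1] the outermost [g2] and [h2] are moved out through [g1^m] and [h1^m], where [f_mul]
   puts them. *)
by rewrite /w f_mul !iterS g12 h12.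
Qed.
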